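(* Let $\alpha_1=1$ and $\alpha_k=\alpha_{k-1}^2+3\alpha_{k-1}+1$ for $k>1$. For every $k\ge 1$ there exists a randomized memoryless algorithm for the weighted $k$-server problem on uniform metric spaces which is $\alpha_k$-competitive against an online adaptive adversary (for every choice of server weights).
   Context: Weighted $k$-server problem on uniform metric spaces: a uniform metric space is a set of points in which any two distinct points are at distance $1$. There are $k$ servers with weights $\beta_1,\dots,\beta_k>0$, each located at a point; moving server $i$ to a different point costs $\beta_i$. Requests (points) arrive online; each request must be served, before the next one is revealed, by having some server at the requested point (moving a server there if none is there). A randomized memoryless algorithm on uniform spaces is specified, for each weight vector $\beta$, by a probability distribution $(p_1,\dots,p_k)$ on the servers: whenever the requested point is not occupied by any of its servers, it moves server $i$ to that point with probability $p_i$, independently of the past; otherwise it does nothing. An online adaptive adversary generates each request after observing the algorithm's behaviour on all previous requests and immediately serves it with its own $k$ servers of the same weights. The algorithm is $c$-competitive against online adaptive adversaries if there is a constant $b$ such that for every such adversary, $\mathbb{E}[\text{cost of algorithm}]\le c\cdot\mathbb{E}[\text{cost of adversary}]+b$; its competitive ratio is the infimum of such $c$. *)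

(* Defs.v *)
From mathcomp Require Import all_boot all_order all_algebra.
From mathcomp Require Import reals.
Set Implicit Arguments.
Unset Strict Implicit.
Unset Printing Implicit Defensive.
Import Order.TTheory GRing.Theory Num.Theory.
Local Open Scope ring_scope.

(* Only the values for k >= 1 are meaningful; alpha 0 is a dummy. *)
Fixpoint alpha (k : nat) : nat :=
  if k is k'.+1 then
    if k' is _.+1 then (alpha k' ^ 2 + 3 * alpha k' + 1)%N else 1%N
  else 0%N.

(* A uniform metric space is given by its set of points, an arbitrary eqType. *)
Definition udist (R : realType) (T : eqType) (x y : T) : R := (x != y)%:R.

(* Several servers may share a point. *)
Definition config (k : nat) (T : eqType) := {ffun 'I_k -> T}.

Definition occupied (k : nat) (T : eqType) (c : config k T) (r : T) : bool :=
  [exists i, c i == r].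

Definition move (k : nat) (T : eqType) (c : config k T) (i : 'I_k) (r : T) :
  config k T := [ffun j => if j == i then r else c j].

Definition move_cost (R : realType) (k : nat) (T : eqType) (beta : 'I_k -> R)
  (c c' : config k T) : R := \sum_i beta i * udist R (c i) (c' i).

Definition path_cost (R : realType) (k : nat) (T : eqType) (beta : 'I_k -> R)
  (c0 : config k T) (cs : seq (config k T)) : R :=
  \sum_(d <- pairmap (move_cost beta) c0 cs) d.

Record memoryless_algorithm (R : realType) (k : nat) := MemorylessAlgorithm {
  server_prob : ('I_k -> R) -> 'I_k -> R;
  server_prob_ge0 : forall beta : 'I_k -> R, (forall i, 0 < beta i) ->
    forall i, 0 <= server_prob beta i;
  server_prob_sum1 : forall beta : 'I_k -> R, (forall i, 0 < beta i) ->
    \sum_i server_prob beta i = 1 }.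

(* The argument h is the list of the configurations of the algorithm after each
   of the previous requests (the initial configuration is fixed before the
   adversary). From h the adversary produces the next request together with its
   own configuration after serving it, before seeing the answer of the algorithm.
   It may move any of its servers; its earlier requests and configurations are
   the values at the prefixes of h. *)
Record adversary (k : nat) (T : eqType) := Adversary {
  request : seq (config k T) -> T;
  serve : seq (config k T) -> config k T;
  serveP : forall h, occupied (serve h) (request h) }.

Definition alg_step (k : nat) (T : eqType) (c : config k T) (r : T)
  (i : 'I_k) : config k T := if occupied c r then c else move c i r.

(* The sequence w lists the random server indices drawn by the algorithm, one per
   request; the index is ignored if the request is already occupied. *)
Definition alg_traj (k : nat) (T : eqType) (c0 : config k T)
  (A : adversary k T) (w : seq 'I_k) : seq (config k T) :=
  foldl (fun h i => rcons h (alg_step (last c0 h) (request A h) i)) [::] w.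

Definition adv_traj (k : nat) (T : eqType) (A : adversary k T)
  (h : seq (config k T)) : seq (config k T) :=
  mkseq (fun t => serve A (take t h)) (size h).

Definition alg_cost (R : realType) (k : nat) (T : eqType) (beta : 'I_k -> R)
  (c0 : config k T) (A : adversary k T) (w : seq 'I_k) : R :=
  path_cost beta c0 (alg_traj c0 A w).

Definition adv_cost (R : realType) (k : nat) (T : eqType) (beta : 'I_k -> R)
  (c0 : config k T) (A : adversary k T) (w : seq 'I_k) : R :=
  path_cost beta c0 (adv_traj A (alg_traj c0 A w)).

(* Expectation of X over n independent draws from the distribution p. *)
Definition expect (R : realType) (k : nat) (p : 'I_k -> R) (n : nat)
  (X : seq 'I_k -> R) : R :=
  \sum_(w : n.-tuple 'I_k) (\prod_(i <- w) p i) * X w.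

(* The algorithm and the adversary start from the same configuration c0. The
   additive constant depends on the weights only: neither on the space, nor on
   c0, nor on the number n of requests. An adversary which stops earlier is
   covered, since it can repeat its last request at no cost for either side. *)
Definition competitive (R : realType) (k : nat) (M : memoryless_algorithm R k)
  (beta : 'I_k -> R) (c : R) : Prop :=
  exists b : R, forall (T : eqType) (c0 : config k T) (A : adversary k T)
    (n : nat),
    expect (server_prob M beta) n (alg_cost beta c0 A) <=
    c * expect (server_prob M beta) n (adv_cost beta c0 A) + b.

(* Main.v *)
Require Import Defs.
From mathcomp Require Import all_boot all_order all_algebra.
From mathcomp Require Import reals.
From mathcomp Require classical_sets.
From mathcomp Require Import zify ring lra.
Import Order.TTheory GRing.Theory Num.Theory.
Local Open Scope ring_scope.

(* The potential is a function v of the set D of servers on which the algorithm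
   and the adversary disagree. A request served by the adversary's server j in D
   repairs j with probability p_j and damages each i outside D with probability
   p_i. Let v be the expected time until D is empty when the adversary always
   repairs the lightest server of D. By induction on the horizon, v is monotone
   and submodular, and p_i (v(D) - v(D \ i)) is smallest for the lightest i in D;
   hence the lightest server is the adversary's best choice and v decreases in
   expectation under every request. By submodularity, what the adversary gains
   by moving server i is at most v({i}). Write w for the same function without
   the heaviest server x. Then v(x + D) - v({x}) <= w(D), so that
   p_x v({x}) <= 1 + sum_i p_i w({i}) <= 1 + alpha_(k-1), and then, on sets
   without x, v <= (2 + alpha_(k-1)) w. So p_i v({i}) <= share_i with
   sum_i share_i = (1 + alpha_(k-1)) + (2 + alpha_(k-1)) alpha_(k-1) = alpha_k,
   and the choice p_i ~ share_i / beta_i balances the servers. *)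

(** * Finite-set tactics, the recurrence for [alpha], and the shares *)

Ltac use_facts := repeat match goal with
  | H : is_true (~~ ?b) |- context [?b] => rewrite (negbTE H)
  | H : ?b = false |- context [?b] => rewrite H
  | H : is_true ?b |- context [?b] => rewrite H
  end.

Ltac set_dec := let z := fresh "z" in
  apply/setP => z; rewrite !inE;
  repeat (match goal with |- context [z == ?x] =>
    case: (eqVneq z x) => [-> | _] /=; rewrite ?eqxx; use_facts;
    rewrite //= ?andbF ?andbT ?orbT ?orbF
  end); try by [].

(** The dummy value [alpha 0 = 0] fits the recurrence, since 0 + 0 + 1 = 1; inductions on the number
    of servers can therefore start at 0. *)
Lemma alphaS n : alpha n.+1 = (alpha n ^ 2 + 3 * alpha n + 1)%N.
Proof. by case: n. Qed.

(* [share n i] bounds the potential of a single misplaced server of rank [i]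
   among [n], in units of 1 / p_i. *)
Fixpoint share n i : nat :=
  if n is n'.+1 then
    if i == n' then (alpha n').+1 else ((alpha n').+2 * share n' i)%N
  else 0%N.

Lemma share_gt0 n i : (i < n)%N -> (0 < share n i)%N.
Proof.
elim: n i => // n IH i; rewrite ltnS leq_eqVlt /=.
by case: eqP => //= _ /IH; rewrite muln_gt0.
Qed.

(** Needed so that dividing shares by weights gives lighter servers the larger probabilities. The
    top share [alpha n + 1] lies below the factor [alpha n + 2] of all others. *)
Lemma share_anti n i j : (i < j)%N -> (j < n)%N -> (share n j <= share n i)%N.
Proof.
elim: n i j => // n IH i j ij jn /=.
have [jn'|jn'] := eqVneq j n.
  rewrite -jn' ltn_eqF //; apply: leq_trans (leq_pmulr _ _) => //.
  by rewrite share_gt0 // -jn'.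
have {}jn : (j < n)%N by rewrite ltn_neqAle jn' -ltnS.
by rewrite ltn_eqF ?(ltn_trans ij) // leq_pmul2l // IH.
Qed.

(** * The repair chain *)

Section RepairChain.
Variables (R : realFieldType) (I : finType) (r : I -> nat).

Definition below i (D : {set I}) := [forall x in D, (r i <= r x)%N].

Lemma belowP i (D : {set I}) :
  reflect {in D, forall x, (r i <= r x)%N} (below i D).
Proof. exact: forall_inP. Qed.

Lemma below_setU1 i x D : below i (x |: D) = (r i <= r x)%N && below i D.
Proof.
apply/belowP/andP => [h | [hx /belowP hD] y].
  by split; [apply: h; rewrite setU11 | apply/belowP => y yD; apply: h; rewrite setU1r].
by rewrite !inE => /orP[/eqP-> | /hD].
Qed.

Lemma below_trans i j D : (r i <= r j)%N -> below j D -> below i D.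
Proof. by move=> ij /belowP h; apply/belowP => x /h; apply: leq_trans. Qed.

Lemma belowN i j (D : {set I}) : (r i < r j)%N -> i \in D -> below j D = false.
Proof.
by move=> ij iD; apply/negP => /belowP /(_ _ iD); rewrite leqNgt ij.
Qed.

(* One step of the chain: a random i is damaged if it is outside D, and repaired
   only if it is the element of least rank of D. *)
Definition act (D : {set I}) (i : I) : {set I} :=
  if i \notin D then i |: D else if below i D then D :\ i else D.

Lemma exists_below (D : {set I}) : D != set0 -> exists2 i, i \in D & below i D.
Proof.
case/set0Pn => x xD; case: (arg_minnP r xD) => i iD h.
by exists i => //; apply/belowP.
Qed.

Implicit Types (p : I -> R) (v w : {set I} -> R).

(** Expectation of [v] after one step of a lazy chain: the probability missing from [\sum_i p i] is
    spent standing still. *)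
Definition avg p v D := (1 - \sum_i p i) * v D + \sum_i p i * v (act D i).

Definition bellman p v D := if D == set0 then 0 else 1 + avg p v D.

(** Expected hitting time of [set0], truncated at [t]. *)
Definition value p t : {set I} -> R := iter t (bellman p) (fun=> 0).

Definition monotone v := forall (E : {set I}) i, i \notin E -> v E <= v (i |: E).

Definition submodular v := forall (E : {set I}) i l,
  i \notin E -> l \notin E -> i != l ->
  v (i |: (l |: E)) + v E <= v (i |: E) + v (l |: E).

(** Each side is the expected drop of [v] when a request lets that one server be repaired; the
    lighter repair is the slower one, hence the better choice for the adversary. *)
Definition prioritized p v := forall (E : {set I}) j l,
  j \notin E -> l \notin E -> (r j < r l)%N ->
  p j * (v (j |: (l |: E)) - v (l |: E)) <= p l * (v (j |: (l |: E)) - v (j |: E)).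

(** * Monotonicity, submodularity and priority survive one step *)

Section Step.
Variables (p : I -> R).
(* Total probability 1/2 instead of 1 leaves the chain still with probability at
   least 1/2, which absorbs the negative terms - p_i * Q below. *)
Hypotheses (p_ge0 : forall i, 0 <= p i) (p_sum : \sum_i p i <= 2^-1).
Hypothesis p_anti : forall i j, (r i < r j)%N -> p j <= p i.
Hypothesis r_inj : injective r.

Lemma p_sum_le1 : 0 <= 1 - \sum_i p i.
Proof. have := p_sum; lra. Qed.

Lemma setU1_neq0 (x : I) (E : {set I}) : (x |: E == set0) = false.
Proof. by apply/negbTE/set0Pn; exists x; rewrite setU11. Qed.

Lemma sum_split2 (F : I -> R) j l : j != l ->
  (forall m, m != j -> m != l -> 0 <= F m) -> F j + F l <= \sum_m F m.
Proof.
move=> jl h; rewrite (bigD1 j) //= (bigD1 l) 1?eq_sym //= addrA lerDl.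
by apply: sumr_ge0 => m /andP[? ?]; apply: h.
Qed.

Lemma sum_split3 (F : I -> R) j l k : j != l -> k != j -> k != l ->
  (forall m, m != j -> m != l -> m != k -> 0 <= F m) ->
  F j + F l + F k <= \sum_m F m.
Proof.
move=> jl kj kl h.
rewrite (bigD1 j) //= (bigD1 l) 1?eq_sym //= (bigD1 k) /= ?kj ?kl // !addrA lerDl.
by apply: sumr_ge0 => m /andP[/andP[? ?] ?]; apply: h.
Qed.

Lemma avg_prioritized v : monotone v -> prioritized p v ->
  prioritized p (avg p v).
Proof.
move=> Mv Wv E j l jE lE jl.
have nlj : (r l <= r j)%N = false by rewrite leqNgt jl.
have lej : (r j <= r l)%N := ltnW jl.
have jNl : j != l by apply/eqP => e; rewrite e ltnn in jl.
have lNj : l != j by rewrite eq_sym.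
have pjl := p_anti _ _ jl.
have pj0 := p_ge0 j. have pl0 := p_ge0 l.
(* [W id >= 0] is the hypothesis on [v], written as a linear form. Averaging is linear, so it
   remains to bound the sum of [p m * W (act^~ m)]. *)
pose W (x : {set I} -> {set I}) := (p l - p j) * v (x (j |: (l |: E)))
  - p l * v (x (j |: E)) + p j * v (x (l |: E)).
have W0 : 0 <= W id by have := Wv E j l jE lE jl; rewrite /W /=; nra.
suff h : 0 <= \sum_m p m * W (act^~ m).
  have: 0 <= (1 - \sum_i p i) * W id + \sum_m p m * W (act^~ m).
    by rewrite addr_ge0 // mulr_ge0 // p_sum_le1.
  pose S D := \sum_m p m * v (act D m).
  have -> : \sum_m p m * W (act^~ m) =
    (p l - p j) * S (j |: (l |: E)) - p l * S (j |: E) + p j * S (l |: E).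
    rewrite !mulr_sumr -sumrB -big_split /=; apply: eq_bigr => m _.
    by rewrite /W; ring.
  by rewrite /avg /W -!/(S _); nra.
(* Such an [m] acts alike on the three sets: it is added to [E] in all of them or changes none. *)
have other m : m != j -> m != l ->
    [|| m \notin E, ~~ below m E | (r l < r m)%N] -> 0 <= W (act^~ m).
  move=> mj ml; case: (boolP (m \in E)) => /= mE.
    move=> nb; suff st : (r m <= r j)%N && (r m <= r l)%N && below m E = false
                      /\ (r m <= r j)%N && below m E = false
                      /\ (r m <= r l)%N && below m E = false.
      case: st => [s1 [s2 s3]].
      by rewrite /W /act !inE !below_setU1 andbA s1 s2 s3; use_facts; rewrite /= ?orbT.
    case/orP: nb => [/negbTE-> | lm]; first by rewrite !andbF.
    by rewrite !(leqNgt (r m)) (ltn_trans jl lm) lm.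
  move=> _; have := Wv (m |: E) j l.
  rewrite !inE !(eq_sym _ m); use_facts => /(_ isT isT isT).
  rewrite /W /act !inE; use_facts; rewrite /= !(setUCA [set m]).
  by nra.
have rest (k : I) : k \in E -> below k E -> forall m, m != j -> m != l -> m != k ->
    0 <= p m * W (act^~ m).
  move=> kE kb m mj ml mk; rewrite mulr_ge0 // other //.
  case: (boolP (m \in E)) => //= mE; apply/orP; left; apply/negP => mb; case/eqP: mk.
  by apply: r_inj; apply/eqP; rewrite eqn_leq (belowP _ _ kb) // (belowP _ _ mb).
have Mj : v (l |: E) <= v (j |: (l |: E)).
  by apply: Mv; rewrite !inE; use_facts.
have [bl|nbl] := boolP (below l E).
  have bj := below_trans _ _ _ lej bl.
  apply: le_trans (_ : _ <= p j * W (act^~ j) + p l * W (act^~ l)) _; last first.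
    apply: (sum_split2 (fun m => p m * W (act^~ m)) j l) => // m mj ml.
    rewrite mulr_ge0 // other //; case: (boolP (m \in E)) => //= mE.
    have := belowP _ _ bl _ mE; rewrite leq_eqVlt => /orP[/eqP/r_inj e|->].
      by rewrite e eqxx in ml.
    by rewrite orbT.
  rewrite /W /act !inE !below_setU1 !eqxx; use_facts; rewrite /= !leqnn /=.
  have -> : (j |: (l |: E)) :\ j = l |: E by set_dec.
  have -> : (j |: E) :\ j = E by set_dec.
  have -> : (l |: E) :\ l = E by set_dec.
  rewrite !(setUCA [set l] [set j]).
  (* The [v E] terms of [j] and [l] cancel, and their sum is exactly this product. *)
  have : 0 <= (p j * (p j - p l)) * (v (j |: (l |: E)) - v (l |: E)).
    by rewrite mulr_ge0 ?subr_ge0 // mulr_ge0 // subr_ge0.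
  nra.
have [m mE mb] : exists2 m, m \in E & below m E.
  apply: exists_below; apply: contra nbl => /eqP->.
  by apply/belowP => x; rewrite inE.
have ml : (r m < r l)%N.
  by rewrite ltnNge; apply: contra nbl => /below_trans; apply.
have lm : (r l <= r m)%N = false by rewrite leqNgt ml.
have lem := ltnW ml.
have mNl : m != l by apply: contraNneq lE => <-.
have mNj : m != j by apply: contraNneq jE => <-.
have jNm : j != m by rewrite eq_sym.
have lNm : l != m by rewrite eq_sym.
have pm0 := p_ge0 m.
apply: le_trans (_ : _ <= p j * W (act^~ j) + p l * W (act^~ l) + p m * W (act^~ m)) _; last first.
  apply: (sum_split3 (fun m => p m * W (act^~ m)) j l m) => // i ij il im.
  exact: rest im.
have lb : below l E = false := belowN _ _ _ ml mE.
pose E' := E :\ m.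
have eE : E = m |: E' by rewrite setD1K.
have mE' : m \notin E' by rewrite !inE eqxx.
have jE' : j \notin E' by rewrite !inE; use_facts; rewrite andbF.
have lE' : l \notin E' by rewrite !inE; use_facts; rewrite andbF.
have Q1 : (j |: (l |: E)) :\ m = j |: (l |: E') by rewrite eE; set_dec.
have Q2 : (j |: E) :\ m = j |: E' by rewrite eE; set_dec.
have Q3 : (l |: E) :\ m = l |: E' by rewrite eE; set_dec.
have Q4 : (j |: (l |: E)) :\ j = l |: E by set_dec.
have Q5 : (j |: E) :\ j = E by set_dec.
have [mj|jm] := ltnP (r m) (r j).
  have lemj := ltnW mj.
  have jb : below j E = false := belowN _ _ _ mj mE.
  have Wm := Wv E' j l jE' lE' jl.
  have W0' := Wv E j l jE lE jl.
  rewrite /W /act !inE !below_setU1 !eqxx; use_facts; rewrite /= ?orbT ?andbF /= Q1 Q2 Q3.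
  rewrite !(setUCA [set l] [set j]).
  have h : 0 <= p m * ((p l - p j) * v (j |: (l |: E')) - p l * v (j |: E') + p j * v (l |: E')).
    apply: mulr_ge0 => //; lra.
  (* Here only [m] is repaired; the terms of [j] and [l] sum to [p j * W id] plus the product in
     [hl]. *)
  have := mulr_ge0 pj0 W0; rewrite /W /= => hj.
  have hl : 0 <= p j * (p j - p l) * (v (j |: (l |: E)) - v (l |: E)).
    by rewrite mulr_ge0 ?subr_ge0 // mulr_ge0 // subr_ge0.
  nra.
have jb : below j E := below_trans _ _ _ jm mb.
have mj : (r m <= r j)%N = false.
  rewrite leqNgt ltn_neqAle jm andbT; apply/negbTE; rewrite negbK.
  by apply: contraNneq mNj => /r_inj->.
rewrite /W /act !inE !below_setU1 !eqxx; use_facts; rewrite /= ?orbT ?andbF /= ?leqnn /= Q3 Q4 Q5.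
rewrite !(setUCA [set l] [set j]).
(* Here [m] is repaired only in [l |: E], where [j] is absent. The loss this causes is made up by
   the priority of [m] over [l] on [E']. *)
have Wml := Wv E' m l mE' lE' ml.
rewrite -eE (setUCA [set m] [set l]) -eE in Wml.
have h1 : 0 <= p j * (p j - p l) * (v (j |: (l |: E)) - v (l |: E)).
  by rewrite mulr_ge0 ?subr_ge0 // mulr_ge0 // subr_ge0.
have h2 : 0 <= p j * (p l * (v (l |: E) - v E) - p m * (v (l |: E) - v (l |: E'))).
  rewrite mulr_ge0 // subr_ge0; move: Wml; lra.
have h3 := mulr_ge0 pm0 W0; rewrite /W /= in h3.
nra.
Qed.

(** Couple the two chains by the same random [m]. Only [m = i] can reverse the order, by repairing
    [i] on one side and damaging it on the other; the probability of standing still is at least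
    [p i] and outweighs this. *)
Lemma avg_monotone v : monotone v -> monotone (avg p v).
Proof.
move=> Mv E i iE.
have MiE := Mv E i iE.
pose F m := v (act (i |: E) m) - v (act E m).
have Fo m : m != i -> 0 <= F m.
  move=> mi; rewrite /F /act !inE !below_setU1 subr_ge0; use_facts; rewrite /=.
  case: (boolP (m \in E)) => mE /=; last first.
    by rewrite setUCA; apply: Mv; rewrite !inE eq_sym; use_facts.
  have e : (i |: E) :\ m = i |: (E :\ m).
    by apply/setP => z; rewrite !inE; case: (eqVneq z i) => [->|]; rewrite ?(eq_sym i) ?mi.
  have le1 : v (E :\ m) <= v E.
    by rewrite -{2}(setD1K mE); apply: Mv; rewrite !inE eqxx.
  case: (below m E); last by rewrite andbF.
  rewrite andbT; case: ifP => _; last exact: le_trans MiE.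
  by rewrite e; apply: Mv; rewrite !inE; use_facts; rewrite andbF.
have Fi : - (v (i |: E) - v E) <= F i.
  rewrite /F /act !inE !below_setU1 eqxx; use_facts; rewrite /=.
  have -> : (i |: E) :\ i = E by set_dec.
  by case: ifP => _; lra.
have h : - (p i * (v (i |: E) - v E)) <= \sum_m p m * F m.
  rewrite (bigD1 i) //=; apply: ler_wpDr.
    by apply: sumr_ge0 => m mi; rewrite mulr_ge0 ?Fo.
  by rewrite -mulrN ler_wpM2l.
have hs : \sum_m p m * F m = \sum_m p m * v (act (i |: E) m) - \sum_m p m * v (act E m).
  by rewrite -sumrB; apply: eq_bigr => m _; rewrite mulrBr.
have pi : p i <= \sum_m p m.
  by rewrite (bigD1 i) //= lerDl sumr_ge0.
have h2 : 0 <= (1 - \sum_m p m - p i) * (v (i |: E) - v E).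
  by rewrite mulr_ge0 ?subr_ge0 //; have := p_sum; lra.
rewrite /avg; move: h; rewrite hs; nra.
Qed.

(** The same coupling on four sets. Drawing [i] may swap them in pairs and yield [- Q id], which
    standing still absorbs; the rest depends on where the lightest [j] of [E] ranks relative to [i]
    and [l]. *)
Lemma avg_submodular v (E : {set I}) i l : monotone v -> submodular v -> prioritized p v ->
  E != set0 -> i \notin E -> l \notin E -> (r i < r l)%N ->
  avg p v (i |: (l |: E)) + avg p v E <= avg p v (i |: E) + avg p v (l |: E).
Proof.
move=> Mv Qv Wv E0 iE lE il.
have [j jE jb] := exists_below _ E0.
have nli : (r l <= r i)%N = false by rewrite leqNgt il.
have lei : (r i <= r l)%N := ltnW il.
have iNl : i != l by apply/eqP => e; rewrite e ltnn in il.
have lNi : l != i by rewrite eq_sym.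
pose Q (x : {set I} -> {set I}) :=
  v (x (i |: E)) + v (x (l |: E)) - v (x (i |: (l |: E))) - v (x E).
have Q0 : 0 <= Q id by have := Qv E i l iE lE iNl; rewrite /Q /=; lra.
have pi0 := p_ge0 i. have pl0 := p_ge0 l. have pj0 := p_ge0 j.
suff h : - (p i * Q id) <= \sum_m p m * Q (act^~ m).
  have pi : p i <= \sum_m p m.
    by rewrite (bigD1 i) //= lerDl sumr_ge0.
  have: 0 <= (1 - \sum_m p m - p i) * Q id.
    by rewrite mulr_ge0 //; have := p_sum; lra.
  pose S D := \sum_m p m * v (act D m).
  have e : \sum_m p m * Q (act^~ m) =
      S (i |: E) + S (l |: E) - S (i |: (l |: E)) - S E.
    rewrite -big_split -!sumrB /=; apply: eq_bigr => m _.
    by rewrite /Q; ring.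
  by move: h; rewrite e /avg /Q /= -!/(S _); nra.
have jNi : j != i by apply: contraNneq iE => <-.
have jNl : j != l by apply: contraNneq lE => <-.
have iNj : i != j by rewrite eq_sym.
have lNj : l != j by rewrite eq_sym.
pose E' := E :\ j.
have eE : E = j |: E' by rewrite setD1K.
have jE' : j \notin E' by rewrite !inE eqxx.
have iE' : i \notin E' by rewrite !inE; use_facts; rewrite andbF.
have lE' : l \notin E' by rewrite !inE; use_facts; rewrite andbF.
have other m : m != i -> m != l -> m != j -> 0 <= p m * Q (act^~ m).
  move=> mi ml mj; rewrite mulr_ge0 //.
  case: (boolP (m \in E)) => mE.
    have mb : below m E = false.
      apply/negP => mb; case/eqP: mj.
      by apply: r_inj; apply/eqP; rewrite eqn_leq (belowP _ _ jb) // (belowP _ _ mb).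
    by rewrite /Q /act !inE !below_setU1; use_facts; rewrite /= !andbF ?orbT.
  have := Qv (m |: E) i l.
  rewrite !inE !(eq_sym _ m); use_facts => /(_ isT isT isT).
  by rewrite /Q /act !inE; use_facts; rewrite /= !(setUCA [set m]); lra.
apply: le_trans (_ : _ <= p i * Q (act^~ i) + p l * Q (act^~ l) + p j * Q (act^~ j)) _; last first.
  exact: (sum_split3 (fun m => p m * Q (act^~ m)) i l j).
have P1 : (i |: (l |: E)) :\ j = i |: (l |: E') by rewrite eE; set_dec.
have P2 : (i |: E) :\ j = i |: E' by rewrite eE; set_dec.
have P3 : (l |: E) :\ j = l |: E' by rewrite eE; set_dec.
have P4 : (i |: (l |: E)) :\ i = l |: E by set_dec.
have P5 : (i |: E) :\ i = E by set_dec.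
have P6 : (l |: E) :\ l = E by set_dec.
have [ji|ij] := ltnP (r j) (r i).
  have jl := ltn_trans ji il.
  have lej := ltnW ji. have lejl := ltnW jl.
  have ib : below i E = false := belowN _ _ _ ji jE.
  have lb : below l E = false := belowN _ _ _ jl jE.
  have Q1 := Qv E' i l iE' lE' iNl.
  rewrite /Q /act !inE !below_setU1 !eqxx; use_facts.
  rewrite /= ?orbT ?andbF /= P1 P2 P3 -/E' !(setUCA [set l] [set i]).
  have : 0 <= p j * (v (i |: E') + v (l |: E') - v (i |: (l |: E')) - v E').
    by rewrite mulr_ge0 //; lra.
  by have := mulr_ge0 pi0 Q0; rewrite /Q /=; nra.
have ji : (r j <= r i)%N = false.
  rewrite leqNgt ltn_neqAle ij andbT; apply/negbTE; rewrite negbK.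
  by apply: contraNneq iNj => /r_inj->.
have ib : below i E := below_trans _ _ _ ij jb.
have Q2 := Qv E' j l jE' lE' jNl.
rewrite (setUCA [set j] [set l]) -eE in Q2.
have hQ := mulr_ge0 pj0 Q0; rewrite /Q /= in hQ.
have [jl|lj] := ltnP (r j) (r l).
  have lejl := ltnW jl.
  have lb : below l E = false := belowN _ _ _ jl jE.
  rewrite /Q /act !inE !below_setU1 !eqxx; use_facts.
  rewrite /= ?orbT ?andbF ?leqnn /= P3 P4 P5 -/E' !(setUCA [set l] [set i]).
  have h2 : 0 <= p j * (v E + v (l |: E') - v (l |: E) - v E').
    by rewrite mulr_ge0 //; lra.
  by nra.
have jl : (r j <= r l)%N = false.
  rewrite leqNgt ltn_neqAle lj andbT; apply/negbTE; rewrite negbK.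
  by apply: contraNneq lNj => /r_inj->.
have lb : below l E := below_trans _ _ _ lj jb.
have lj' : (r l < r j)%N by rewrite ltnNge jl.
(* Drawing [l] loses [p l * (v (l |: E) - v E)]. By the priority of [l] over [j] this is at most
   [p j * (v (l |: E) - v (l |: E'))], and submodularity bounds that by the gain from repairing [j]
   in [E]. *)
have W1 := Wv E' l j lE' jE' lj'.
rewrite -eE in W1.
rewrite /Q /act !inE !below_setU1 !eqxx; use_facts.
rewrite /= ?orbT ?andbF ?leqnn /= P4 P5 P6 -/E' !(setUCA [set l] [set i]).
have h2 : 0 <= p j * (v E + v (l |: E') - v (l |: E) - v E').
  by rewrite mulr_ge0 //; lra.
by nra.
Qed.

Lemma avg_ge0 v D : (forall E, 0 <= v E) -> 0 <= avg p v D.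
Proof.
move=> v0; rewrite /avg addr_ge0 ?mulr_ge0 ?p_sum_le1 //.
by apply: sumr_ge0 => i _; rewrite mulr_ge0.
Qed.

Lemma value_ge0 t D : 0 <= value p t D.
Proof.
elim: t D => //= t IH D; rewrite /bellman; case: ifP => // _.
by rewrite addr_ge0 ?avg_ge0.
Qed.

Lemma bellman_monotone v : (forall E, 0 <= v E) -> monotone v ->
  monotone (bellman p v).
Proof.
move=> v0 Mv E i iE; rewrite /bellman setU1_neq0; case: ifP => _.
  by rewrite addr_ge0 ?avg_ge0.
by rewrite lerD2l avg_monotone.
Qed.

Lemma bellman_prioritized v : monotone v -> prioritized p v ->
  prioritized p (bellman p v).
Proof.
move=> Mv Wv E j l jE lE jl; rewrite /bellman !setU1_neq0.
by have := avg_prioritized v Mv Wv E j l jE lE jl; lra.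
Qed.

Lemma bellman_submodular_lt v (E : {set I}) i l : (forall E, 0 <= v E) ->
  monotone v -> submodular v -> prioritized p v ->
  i \notin E -> l \notin E -> (r i < r l)%N ->
  bellman p v (i |: (l |: E)) + bellman p v E
    <= bellman p v (i |: E) + bellman p v (l |: E).
Proof.
move=> v0 Mv Qv Wv iE lE il; rewrite /bellman !setU1_neq0.
(* On empty [E], [bellman] is 0 instead of [1 + avg], so that case comes down to subadditivity: its
   [Q] drops the term [v E]. *)
case: ifP => E0; last first.
  by have := avg_submodular v E i l Mv Qv Wv (negbT E0) iE lE il; lra.
have iNl : i != l by apply/eqP => e; rewrite e ltnn in il.
have lNi : l != i by rewrite eq_sym.
pose Q (x : {set I} -> {set I}) :=
  v (x (i |: E)) + v (x (l |: E)) - v (x (i |: (l |: E))).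
have nin m : m \notin E by rewrite (eqP E0) inE.
have bE m : below m E by apply/belowP => x; rewrite (eqP E0) inE.
have nli : (r l <= r i)%N = false by rewrite leqNgt il.
have lei : (r i <= r l)%N := ltnW il.
suff h m : 0 <= Q (act^~ m).
  have Q0 : 0 <= Q id.
    by have := Qv E i l iE lE iNl; have := v0 E; rewrite /Q /=; lra.
  have h1 : 0 <= (1 - \sum_m p m) * Q id by rewrite mulr_ge0 ?p_sum_le1.
  have h2 : 0 <= \sum_m p m * Q (act^~ m).
    by apply: sumr_ge0 => m _; rewrite mulr_ge0.
  pose S D := \sum_m p m * v (act D m).
  have e : \sum_m p m * Q (act^~ m) = S (i |: E) + S (l |: E) - S (i |: (l |: E)).
    rewrite -big_split -!sumrB /=; apply: eq_bigr => m _.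
    by rewrite /Q; ring.
  by move: h1 h2; rewrite e /avg /Q /= -!/(S _); nra.
have P4 : (i |: (l |: E)) :\ i = l |: E by set_dec.
have P5 : (i |: E) :\ i = E by set_dec.
have P6 : (l |: E) :\ l = E by set_dec.
have bi := bE i. have bl := bE l.
have [-> | mi] := eqVneq m i.
  rewrite /Q /act !inE !below_setU1 !eqxx; use_facts; rewrite /= ?leqnn /= P4 P5.
  have : v (l |: E) <= v (i |: (l |: E)) by apply: Mv; rewrite !inE; use_facts.
  by have := v0 E; lra.
have [-> | ml] := eqVneq m l.
  rewrite /Q /act !inE !below_setU1 !eqxx; use_facts; rewrite /= ?leqnn /= P6.
  by rewrite (setUCA [set l] [set i]); have := v0 E; lra.
have := Qv (m |: E) i l; have := v0 (m |: E).
rewrite !inE !(eq_sym _ m) /Q /act !inE (negbTE (nin m)); use_facts.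
by move=> ? /(_ isT isT isT) /=; rewrite !(setUCA [set m]); lra.
Qed.

Lemma value_structure t : [/\ monotone (value p t), submodular (value p t)
  & prioritized p (value p t)].
Proof.
elim: t => [|t [Mv Qv Wv]].
  by split=> [E i _|E i l _ _ _|E j l _ _ _] //=; lra.
have v0 := value_ge0 t.
split; [exact: bellman_monotone | | exact: bellman_prioritized].
move=> E i l iE lE il.
case: (ltngtP (r i) (r l)) => h; first exact: bellman_submodular_lt.
  by rewrite (setUCA [set i] [set l]) [leRHS]addrC; apply: bellman_submodular_lt.
by rewrite (r_inj _ _ h) eqxx in il.
Qed.

Lemma avgE v D : avg p v D = v D + \sum_i p i * (v (act D i) - v D).
Proof.
rewrite /avg mulrBl mul1r -addrA; congr (_ + _).
rewrite addrC mulr_suml -sumrB.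
by apply: eq_bigr => i _; rewrite mulrBr.
Qed.

(** A chain started inside [A] stays there, so comparing the functions on subsets of [A] is
    enough. *)
Lemma avg_le (A : {set I}) v w : (forall i, i \notin A -> p i = 0) ->
  (forall D : {set I}, D \subset A -> v D <= w D) ->
  forall D : {set I}, D \subset A -> avg p v D <= avg p w D.
Proof.
move=> pA vw D DA; rewrite /avg lerD ?ler_wpM2l ?p_sum_le1 ?vw //.
apply: ler_sum => i _; have [iA|iA] := boolP (i \in A); last by rewrite pA ?mul0r.
rewrite ler_wpM2l // vw // /act.
case: ifP => _; first by rewrite subUset sub1set iA.
by case: ifP => // _; apply: subset_trans DA; apply: subsetDl.
Qed.

Lemma value_set0 t : value p t set0 = 0.
Proof. by case: t => //= t; rewrite /bellman eqxx. Qed.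

Lemma valueS t (D : {set I}) : D != set0 -> value p t.+1 D = 1 + avg p (value p t) D.
Proof. by move=> D0; rewrite /= /bellman (negbTE D0). Qed.

Lemma value_leS t D : value p t D <= value p t.+1 D.
Proof.
elim: t D => [|t IH] D; first exact: value_ge0.
have [->|D0] := eqVneq D set0; first by rewrite !value_set0.
rewrite !valueS // lerD2l; apply: (avg_le setT) => [i|E _|]; rewrite ?inE //.
Qed.

(** Add the elements of [D] one at a time and telescope the submodular inequalities. *)
Lemma value_subadditive t (E D : {set I}) i : [disjoint E & D] -> i \notin D -> i \notin E ->
  value p t (i |: (D :|: E)) + value p t E <= value p t (D :|: E) + value p t (i |: E).
Proof.
have [_ Qv _] := value_structure t.
have [n] := ubnP #|D|; elim: n D => // n IH D.
have [->|[x xD]] := set_0Vmem D; first by rewrite set0U addrC.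
rewrite ltnS (cardsD1 x) xD => cD ED iD iE.
have ix : i != x by apply: contraNneq iD => ->.
have xE : x \notin E.
  by apply/negP => xE; move/pred0P: ED => /(_ x); rewrite /= xE xD.
have iDx : i \notin D :\ x by rewrite !inE (negbTE iD) andbF.
have EDx : [disjoint E & D :\ x].
  by apply: disjointWr ED; apply: subsetDl.
have h := IH (D :\ x) cD EDx iDx iE.
have := Qv (D :\ x :|: E) i x.
rewrite (setUA [set x]) setD1K // !inE eqxx (negbTE iD) (negbTE iE) (negbTE xE) ix andbF.
move=> /(_ isT isT isT); move: h; lra.
Qed.

Lemma value_setU1_le t (D : {set I}) i : i \notin D ->
  value p t (i |: D) <= value p t D + value p t [set i].
Proof.
move=> iD; have := value_subadditive t set0 D i.
rewrite !setU0 value_set0 addr0; apply => //; last by rewrite inE.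
by apply/pred0P => x; rewrite /= inE.
Qed.

(* The chain repairs the element of least rank, and by [prioritized] this is
   the slowest of all repairs. *)
Lemma value_supersolution t (D : {set I}) j : j \in D ->
  value p t D + 1 + \sum_(i | i \notin D) p i * (value p t (i |: D) - value p t D)
    - p j * (value p t D - value p t (D :\ j)) <= value p t.+1 D.
Proof.
move=> jD; have D0 : D != set0 by apply/set0Pn; exists j.
have [k kD kb] := exists_below _ D0.
have [_ _ Wv] := value_structure t; set v := value p t in Wv *.
have kj : p k * (v D - v (D :\ k)) <= p j * (v D - v (D :\ j)).
  have := belowP _ _ kb _ jD; rewrite leq_eqVlt => /orP[/eqP/r_inj-> // | lt].
  have kNj : k != j by apply/eqP => e; rewrite e ltnn in lt.
  have := Wv (D :\ k :\ j) k j; rewrite !inE !eqxx /= andbF => /(_ isT isT lt).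
  have e1 : j |: (D :\ k :\ j) = D :\ k by rewrite setD1K // !inE eq_sym kNj.
  have e2 : k |: (D :\ k :\ j) = D :\ j.
    apply/setP => z; rewrite !inE; case: (eqVneq z k) => [->|] /=; last by [].
    by rewrite kNj.
  by rewrite e1 e2 setD1K.
have -> : value p t.+1 D = 1 + (v D + (- (p k * (v D - v (D :\ k)))
    + \sum_(i | i \notin D) p i * (v (i |: D) - v D))).
  rewrite valueS // avgE -/v (bigID (mem D)) /= (bigD1 k) //= big1 ?addr0.
    rewrite {1}/act kD kb /= -mulrN opprB; congr (_ + (_ + (_ + _))).
    by apply: eq_bigr => i iD; rewrite /act iD.
  move=> i /andP[iD ik]; rewrite /act iD /=; case: ifP => [ib|_]; last by rewrite subrr mulr0.
  case/eqP: ik; apply: r_inj; apply/eqP.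
  by rewrite eqn_leq (belowP _ _ kb) // (belowP _ _ ib).
by move: kj; lra.
Qed.
End Step.

(** * Bounds on single misplaced servers, adding one rank at a time *)

Section Ranks.
Hypothesis r_inj : injective r.

Lemma sum_rank_le n (F : I -> R) c : 0 <= c -> (forall x, r x = n -> F x <= c) ->
  \sum_(i | r i == n) F i <= c.
Proof.
move=> c0 Fc; have [x /eqP rx|no] := pickP (fun i => r i == n).
  rewrite (big_pred1 x) ?Fc // => i /=.
  by rewrite -rx; apply/eqP/eqP => [/r_inj|->].
by rewrite big_pred0.
Qed.

Lemma share_sum n : \sum_(i | (r i < n)%N) (share n (r i))%:R <= (alpha n)%:R :> R.
Proof.
elim: n => [|n IH]; first by rewrite big_pred0.
rewrite alphaS (bigID (fun i => r i == n)) /=.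
rewrite (eq_bigl (fun i => r i == n)); last first.
  by move=> i /=; case: eqP => [->|]; rewrite ?ltnSn ?andbF.
apply: le_trans (_ : _ <= (alpha n).+1%:R + (alpha n).+2%:R * (alpha n)%:R) _.
  apply: lerD.
    by apply: sum_rank_le => [|x ->]; rewrite ?eqxx.
  apply: le_trans (ler_wpM2l (ler0n _ _) IH).
  rewrite mulr_sumr (eq_bigl (fun i => (r i < n)%N)); last first.
    by move=> i /=; rewrite ltnS; case: ltngtP.
  by apply: ler_sum => i lt; rewrite ltn_eqF // natrM.
by rewrite -natrM -natrD ler_nat; nia.
Qed.
End Ranks.

Section Levels.
Variable (p : I -> R).
Hypotheses (p_ge0 : forall i, 0 <= p i) (p_sum : \sum_i p i <= 2^-1).
Hypothesis p_anti : forall i j, (r i < r j)%N -> p j <= p i.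
Hypothesis r_inj : injective r.

(** Heavier servers are removed by giving them probability 0; the state space stays the same, so
    chains for different [n] can be compared. *)
Definition trunc n i := if (r i < n)%N then p i else 0.

Lemma trunc_ge0 n i : 0 <= trunc n i.
Proof. by rewrite /trunc; case: ifP. Qed.

Lemma trunc_sum n : \sum_i trunc n i <= 2^-1.
Proof.
apply: le_trans p_sum; apply: ler_sum => i _.
by rewrite /trunc; case: ifP.
Qed.

Lemma trunc_anti n i j : (r i < r j)%N -> trunc n j <= trunc n i.
Proof.
move=> ij; rewrite /trunc; case: (ltnP (r j) n) => jn.
  by rewrite (ltn_trans ij jn) p_anti.
by case: ifP.
Qed.

Definition ranks_lt n := [set i | (r i < n)%N].

Lemma truncN n i : i \notin ranks_lt n -> trunc n i = 0.
Proof. by rewrite inE /trunc => /negbTE->. Qed.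

(* As long as D is nonempty, x stays damaged and the chain on x |: D moves like
   the chain without x. *)
Lemma value_top n t x (D : {set I}) : r x = n -> D \subset ranks_lt n ->
  value (trunc n.+1) t (x |: D) - value (trunc n.+1) t [set x] <= value (trunc n) t D.
Proof.
move=> rx; elim: t D => [|t IH] D DA; first by rewrite /= subrr.
have [->|D0] := eqVneq D set0; first by rewrite setU0 subrr value_set0.
set v := value (trunc n.+1) t in IH.
have xD : x \notin D.
  by apply/negP => /(subsetP DA); rewrite inE rx ltnn.
(* The offset is wanted at horizon [t.+1] while induction supplies it at [t]; growth in the horizon
   bridges the two. *)
have := value_leS _ (trunc_ge0 n.+1) (trunc_sum n.+1) t [set x]; rewrite -/v.
have x0 : [set x] != set0 by apply/set0Pn; exists x; rewrite inE.
rewrite !valueS ?setU1_neq0 // -/v.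
suff -> : avg (trunc n.+1) v (x |: D) =
    avg (trunc n) (fun E => v (x |: E) - v [set x]) D + v [set x].
  have : avg (trunc n) (fun E => v (x |: E) - v [set x]) D <= avg (trunc n) (value (trunc n) t) D.
    apply: (avg_le _ (trunc_ge0 n) (trunc_sum n) (ranks_lt n)).
    - exact: truncN.
    - exact: IH.
    - exact: DA.
  lra.
rewrite !avgE addrAC subrK; congr (_ + _); apply: eq_bigr => i _.
have [->|ix] := eqVneq i x.
  rewrite {2}/trunc rx ltnn mul0r /act !inE eqxx below_setU1 leqnn /=.
  have [y yD yb] := exists_below _ D0.
  rewrite (belowN y x D _ yD) ?subrr ?mulr0 // rx.
  by have := subsetP DA _ yD; rewrite inE.
have rin : r i != n by apply: contraNneq ix => e; apply/eqP/r_inj; rewrite rx.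
rewrite /trunc ltnS leq_eqVlt (negbTE rin) /=; case: ifP => [lt|]; last by rewrite !mul0r.
congr (_ * _); rewrite /act !inE (negbTE ix) below_setU1 rx (ltnW lt) /=.
case: ifP => iD; first by rewrite setUCA; lra.
case: ifP => _; last by lra.
have -> : (x |: D) :\ i = x |: D :\ i.
  apply/setP => z; rewrite !inE; case: (eqVneq z x) => [->|] //=.
  by rewrite eq_sym (negbTE ix).
lra.
Qed.

Lemma trunc_sumS n (F : I -> R) :
  \sum_i trunc n.+1 i * F i = \sum_i trunc n i * F i + \sum_(i | r i == n) p i * F i.
Proof.
rewrite [X in _ + X]big_mkcond -big_split /=; apply: eq_bigr => i _.
rewrite /trunc ltnS leq_eqVlt; case: (ltngtP (r i) n) => _ /=; lra.
Qed.

(** Damage to the extra server of rank [n] adds at most [c] to the drift, since it raises the value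
    by no more than the singleton value. A step thus counts for at most [c + 1] instead of 1. *)
Lemma value_raise n t c (D : {set I}) : 0 <= c ->
  (forall s x, r x = n -> p x * value (trunc n.+1) s [set x] <= c) ->
  D \subset ranks_lt n ->
  value (trunc n.+1) t D <= (c + 1) * value (trunc n) t D.
Proof.
move=> c0 hc; elim: t D => [|t IH] D DA; first by rewrite /= mulr0.
have [->|D0] := eqVneq D set0; first by rewrite !value_set0 mulr0.
rewrite !valueS //; set v := value (trunc n.+1) t in IH *; set w := value (trunc n) t in IH *.
have h1 : \sum_(i | r i == n) p i * (v (act D i) - v D) <= c.
  apply: (sum_rank_le r_inj) => // x rx; apply: le_trans (hc t x rx).
  rewrite ler_wpM2l //.
  have xD : x \notin D by apply/negP => /(subsetP DA); rewrite inE rx ltnn.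
  rewrite /act xD lerBlDl.
  exact: (value_setU1_le _ (trunc_ge0 _) (trunc_sum _) (trunc_anti _) r_inj).
have h2 : avg (trunc n) v D <= avg (trunc n) (fun E => (c + 1) * w E) D.
  apply: (avg_le _ (trunc_ge0 n) (trunc_sum n) (ranks_lt n)).
  - exact: truncN.
  - exact: IH.
  - exact: DA.
have h3 : avg (trunc n) (fun E => (c + 1) * w E) D = (c + 1) * avg (trunc n) w D.
  rewrite /avg mulrDr mulr_sumr; congr (_ + _); first by ring.
  by apply: eq_bigr => i _; ring.
move: h2; rewrite h3 avgE => h2; rewrite avgE trunc_sumS; move: h1 h2; lra.
Qed.

Lemma value_set1_le n t i : (r i < n)%N ->
  p i * value (trunc n) t [set i] <= (share n (r i))%:R.
Proof.
elim: n t i => // n IH.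
have top s x : r x = n -> p x * value (trunc n.+1) s [set x] <= (alpha n).+1%:R.
  move=> rx; set v := value (trunc n.+1) s.
  have x0 : [set x] != set0 by apply/set0Pn; exists x; rewrite inE.
  (* Expanding horizon [s.+1] by one step and cancelling the value at horizon [s] isolates [p x * v
     [set x]]. *)
  have := value_leS _ (trunc_ge0 n.+1) (trunc_sum n.+1) s [set x].
  rewrite valueS // avgE -/v trunc_sumS.
  have -> : \sum_(i | r i == n) p i * (v (act [set x] i) - v [set x]) = - (p x * v [set x]).
    rewrite (big_pred1 x); last first.
      by move=> i /=; rewrite -rx; apply/eqP/eqP => [/r_inj|->].
    rewrite /act inE eqxx -[[set x]]setU0 below_setU1 leqnn /=.
    have -> : below x set0 by apply/belowP => y; rewrite inE.
    by rewrite setU0 setDv [v set0]value_set0 sub0r mulrN.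
  have h : \sum_i trunc n i * (v (act [set x] i) - v [set x]) <= (alpha n)%:R.
    apply: le_trans (share_sum r_inj n); rewrite [leRHS]big_mkcond /=.
    apply: ler_sum => i _; rewrite /trunc; case: ifP => lt; last by rewrite mul0r.
    apply: le_trans (IH s i lt); rewrite ler_wpM2l //.
    have ix : i != x by apply/eqP => e; rewrite e rx ltnn in lt.
    rewrite /act inE ix setUC.
    by apply: value_top => //; apply/subsetP => y; rewrite !inE => /eqP->.
  by rewrite -natr1; move: h; lra.
move=> t i; rewrite ltnS leq_eqVlt => /orP[/eqP rin|lt] /=.
  by rewrite rin eqxx; apply: top.
rewrite ltn_eqF // natrM.
(* [top] supplies [c = alpha n + 1], which is the source of the factor [alpha n + 2] in [share]. *)
have raise : value (trunc n.+1) t [set i] <= ((alpha n).+1%:R + 1) * value (trunc n) t [set i].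
  apply: value_raise; [exact: ler0n | exact: top | ].
  by apply/subsetP => y; rewrite !inE => /eqP->.
apply: le_trans (ler_wpM2l (p_ge0 i) raise) _.
by rewrite natr1 mulrCA ler_wpM2l ?ler0n // IH.
Qed.

Lemma finite_horizon_potential n : (forall i, (r i < n)%N) ->
  exists u : nat -> {set I} -> R,
  [/\ forall t, u t set0 = 0,
      forall t D, u t D <= u t.+1 D,
      forall t (D : {set I}) i, i \notin D ->
        u t D <= u t (i |: D) <= u t D + u t [set i],
      forall t i, p i * u t [set i] <= (share n (r i))%:R
    & forall t (D : {set I}) j, j \in D ->
        u t D + 1 + \sum_(i | i \notin D) p i * (u t (i |: D) - u t D)
          - p j * (u t D - u t (D :\ j)) <= u t.+1 D].
Proof.
move=> rn; exists (value (trunc n)).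
have q0 := trunc_ge0 n. have qs := trunc_sum n. have qa := trunc_anti n.
have qp i : trunc n i = p i by rewrite /trunc rn.
split=> [t|t D|t D i iD|t i|t D j jD].
- exact: value_set0.
- exact: value_leS.
- by have [Mv _ _] := value_structure _ q0 qs qa r_inj t; rewrite Mv ?value_setU1_le.
- exact: value_set1_le.
- have := value_supersolution _ q0 qs qa r_inj t D j jD; rewrite qp.
  by under eq_bigr => i _ do rewrite qp.
Qed.
End Levels.
End RepairChain.

(** * Passage to the infinite horizon *)

Lemma uniform_sup (R : realType) (T : finType) (u : nat -> T -> R) (B : T -> R) :
  (forall t x, u t x <= u t.+1 x) -> (forall t x, u t x <= B x) ->
  exists v : T -> R, (forall t x, u t x <= v x) /\
    (forall e, 0 < e -> exists t, forall x, v x - e < u t x).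
Proof.
move=> uS uB.
have umono x : {homo u^~ x : s t / (s <= t)%N >-> s <= t}.
  by apply: homo_leq => //; apply: le_trans.
pose A x : classical_sets.set R := fun y => exists t, y = u t x.
have supA x : classical_sets.has_sup (A x).
  split; first by exists (u 0%N x), 0%N.
  by exists (B x) => _ [t ->].
exists (fun x => sup (A x)); split=> [t x|e e0].
  by apply: (sup_upper_bound (supA x)); exists t.
have near x : exists t, sup (A x) - e < u t x.
  by have [_ [t ->] ?] := sup_adherent e0 (supA x); exists t.
(* As [T] is finite, the maximum of the pointwise horizons serves all [x] at once. *)
have [n] := fin_all_exists near.
move=> f; exists (\max_x n x) => x; apply: lt_le_trans (f x) _.
exact: umono (leq_bigmax x).
Qed.

Lemma le_of_approx (R : realFieldType) (x y : R) :
  (forall e, 0 < e -> x - e < y) -> x <= y.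
Proof. by move=> h; apply/ler_addgt0Pr => e /h; lra. Qed.

Lemma potential_exists (R : realType) (I : finType) (r : I -> nat) (p : I -> R) n :
  injective r -> (forall i, (r i < n)%N) ->
  (forall i, 0 < p i) -> \sum_i p i <= 2^-1 ->
  (forall i j, (r i < r j)%N -> p j <= p i) ->
  exists v : {set I} -> R,
  [/\ v set0 = 0,
      forall (D : {set I}) i, i \notin D -> v D <= v (i |: D),
      forall (D : {set I}) i, i \notin D ->
        p i * (v (i |: D) - v D) <= (share n (r i))%:R
    & forall (D : {set I}) j, j \in D ->
        1 + \sum_(i | i \notin D) p i * (v (i |: D) - v D) <= p j * (v D - v (D :\ j))].
Proof.
move=> r_inj rn p_gt0 p_sum p_anti.
have p_ge0 i := ltW (p_gt0 i).
have [u [u0 uS uU u1 uD]] := finite_horizon_potential R I r p p_ge0 p_sum p_anti r_inj n rn.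
have u1' t i : u t [set i] <= (share n (r i))%:R / p i.
  by rewrite ler_pdivlMr // mulrC.
(* Subadditivity over singletons gives a bound independent of [t], which makes the suprema
   finite. *)
have uB t D : u t D <= \sum_(i in D) (share n (r i))%:R / p i.
  have [m] := ubnP #|D|; elim: m D => // m IH D.
  have [->|[x xD]] := set_0Vmem D; first by rewrite u0 big_set0.
  rewrite ltnS (cardsD1 x) xD => cD; rewrite (big_setD1 x) //=.
  have xDx : x \notin D :\ x by rewrite !inE eqxx.
  have /andP[_] := uU t _ _ xDx; rewrite setD1K // => h.
  by apply: le_trans h _; rewrite addrC lerD ?IH.
have [v [uv vu]] := uniform_sup R {set I} u _ uS uB.
exists v; split.
- apply/le_anti/andP; split; last by rewrite -(u0 0%N).
  by apply: le_of_approx => e /vu[t /(_ set0)]; rewrite u0.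
- move=> D i iD; apply: le_of_approx => e /vu[t /(_ D) h].
  have /andP[h1 _] := uU t _ _ iD; apply: lt_le_trans h _.
  exact: le_trans h1 (uv t _).
- move=> D i iD; rewrite mulrC -ler_pdivlMr // lerBlDl.
  apply: le_of_approx => e /vu[t /(_ (i |: D)) h].
  have /andP[_ h1] := uU t _ _ iD; apply: lt_le_trans h _; apply: le_trans h1 _.
  by rewrite lerD.
move=> D j jD; apply: le_of_approx => e e0; have [t ht] := vu e e0.
have hD := uD t D j jD; have vD := uv t.+1 D.
pose s := \sum_(i | i \notin D) p i.
have sj : s + p j <= 2^-1.
  apply: le_trans p_sum; rewrite [leRHS](bigID (mem D)) /= [s + _]addrC lerD2r.
  by rewrite (bigD1 j) //= lerDl sumr_ge0.
have hs : \sum_(i | i \notin D) p i * (v (i |: D) - v D) <=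
    \sum_(i | i \notin D) p i * (u t (i |: D) - u t D) + s * (e + u t D - v D).
  rewrite /s mulr_suml -big_split /=; apply: ler_sum => i _.
  rewrite -mulrDr ler_wpM2l //; have := ht (i |: D); lra.
have hj : p j * v (D :\ j) <= p j * (u t (D :\ j) + e).
  by rewrite ler_wpM2l //; have := ht (D :\ j); lra.
(* All approximation errors and the slack [e] collect into this product; it is positive because
   [s + p j] is at most 1/2. *)
have hd : 0 < (1 - s - p j) * (e + u t D - v D).
  rewrite mulr_gt0 //; last by have := ht D; lra.
  by move: sj; lra.
nra.
Qed.

(** * The potential method *)

Lemma path_cost_rcons (R : realType) k (T : eqType) (beta : 'I_k -> R)
  (c0 : config k T) cs c :
  path_cost beta c0 (rcons cs c) = path_cost beta c0 cs + move_cost beta (last c0 cs) c.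
Proof. by rewrite /path_cost -cats1 pairmap_cat big_cat /= big_cons big_nil addr0. Qed.

Lemma alg_traj_rcons k (T : eqType) (c0 : config k T) (A : adversary k T) w i :
  alg_traj c0 A (rcons w i) = rcons (alg_traj c0 A w)
    (alg_step (last c0 (alg_traj c0 A w)) (request A (alg_traj c0 A w)) i).
Proof. by rewrite /alg_traj foldl_rcons. Qed.

Lemma adv_traj_rcons k (T : eqType) (A : adversary k T) h c :
  adv_traj A (rcons h c) = rcons (adv_traj A h) (serve A h).
Proof.
rewrite /adv_traj size_rcons mkseqS; congr rcons.
  apply/eq_in_map => t; rewrite mem_iota add0n /= => lt.
  by rewrite -cats1 takel_cat // ltnW.
by rewrite -cats1 take_size_cat.
Qed.

Lemma sum_tuple_rcons (V : nmodType) (I : finType) n (F : seq I -> V) :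
  \sum_(w : n.+1.-tuple I) F w = \sum_(w : n.-tuple I) \sum_i F (rcons w i).
Proof.
have unrcons (t : n.+1.-tuple I) :
    rcons (belast (thead t) (behead t)) (last (thead t) (behead t)) = t.
  by case: (tupleP t) => x s; rewrite /= theadE -lastI.
rewrite pair_big /=.
rewrite (reindex (fun wi : n.-tuple I * I => [tuple of rcons wi.1 wi.2])) //=.
exists (fun w : n.+1.-tuple I =>
  ([tuple of belast (thead w) (behead w)], last (thead w) (behead w))) => [[w i] _|w _].
  have /rcons_inj[e1 e2] := unrcons [tuple of rcons w i].
  by congr (_, _); [apply: val_inj | ].
by apply: val_inj; apply: unrcons.
Qed.

Lemma expectS (R : realType) k (p : 'I_k -> R) n X :
  expect p n.+1 X = expect p n (fun w => \sum_i p i * X (rcons w i)).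
Proof.
rewrite /expect (sum_tuple_rcons _ _ _ (fun w => (\prod_(i <- w) p i) * X w)).
apply: eq_bigr => w _; rewrite mulr_sumr; apply: eq_bigr => i _.
by rewrite big_rcons /=; ring.
Qed.

Lemma expect0 (R : realType) k (p : 'I_k -> R) X : expect p 0 X = X [::].
Proof.
rewrite /expect (big_pred1 [tuple]) ?big_nil ?mul1r // => w.
by apply/esym/eqP; exact: tuple0.
Qed.

(** The supermartingale inequality, with the draws made so far as history. *)
Lemma expect_le_init (R : realType) k (p : 'I_k -> R) X n : (forall i, 0 <= p i) ->
  (forall w, \sum_i p i * X (rcons w i) <= X w) -> expect p n X <= X [::].
Proof.
move=> p0 h; elim: n => [|n IH]; first by rewrite expect0.
rewrite expectS; apply: le_trans IH; apply: ler_sum => w _.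
by rewrite ler_wpM2l // prodr_ge0.
Qed.

Section PotentialMethod.
Variables (R : realType) (k : nat) (p beta : 'I_k -> R) (c : R) (v : {set 'I_k} -> R).
Hypotheses (p_ge0 : forall i, 0 <= p i) (p_sum : \sum_i p i = 1).
Hypotheses (beta_ge0 : forall i, 0 <= beta i) (c_ge0 : 0 <= c) (v0 : v set0 = 0).
Hypothesis v_mono : forall (D : {set 'I_k}) i, i \notin D -> v D <= v (i |: D).
Hypothesis v_lip : forall (D : {set 'I_k}) i, i \notin D -> v (i |: D) <= v D + c * beta i.
Hypothesis v_drift : forall (D : {set 'I_k}) j, j \in D ->
  \sum_i p i * beta i + \sum_(i | i \notin D) p i * (v (i |: D) - v D)
    <= p j * (v D - v (D :\ j)).

Lemma potential_setU (D M : {set 'I_k}) :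
  v D <= v (D :|: M) <= v D + \sum_(i in M) c * beta i.
Proof.
have [m] := ubnP #|M|; elim: m M => // m IH M.
have [->|[x xM]] := set_0Vmem M; first by rewrite setU0 big_set0 addr0 lexx.
rewrite ltnS (cardsD1 x) xM => cM; rewrite (big_setD1 x) //=.
have /andP[h1 h2] := IH (M :\ x) cM.
have -> : D :|: M = x |: (D :|: M :\ x) by rewrite setUCA setD1K.
have [xD|xD] := boolP (x \in D :|: M :\ x).
  rewrite (setUidPr _) ?sub1set // h1 /=; apply: le_trans h2 _.
  by rewrite lerD2l lerDr mulr_ge0.
rewrite (le_trans h1) ?v_mono //=; have := v_lip _ _ xD; move: h2; lra.
Qed.

Lemma potential_le (D E : {set 'I_k}) : D \subset E -> v D <= v E.
Proof.
by move=> /setUidPr <-; case/andP: (potential_setU D E).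
Qed.

Lemma potential_ge0 D : 0 <= v D.
Proof. by rewrite -v0; apply/potential_le/sub0set. Qed.

Variable T : eqType.
Implicit Types a s : config k T.

Definition disagree a s := [set i | a i != s i].

Lemma disagreexx a : disagree a a = set0.
Proof. by apply/setP => i; rewrite !inE eqxx. Qed.

Lemma potential_serve a s s' :
  v (disagree a s') <= v (disagree a s) + c * move_cost beta s s'.
Proof.
apply: le_trans (_ : _ <= v (disagree a s :|: disagree s s')) _.
  apply: potential_le; apply/subsetP => i; rewrite !inE; apply: contraR.
  by rewrite negb_or !negbK => /andP[/eqP-> /eqP->].
have /andP[_ h] := potential_setU (disagree a s) (disagree s s').
apply: le_trans h _; rewrite lerD2l mulr_sumr big_mkcond /=.
apply: ler_sum => i _; rewrite inE /udist.
by case: (s i != s' i); rewrite ?mulr1 ?mulr0.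
Qed.

(** On a fault, the adversary's server [j] at the request lies in the disagreement set [D]. Drawing
    [j] repairs it, drawing [i] outside [D] damages at most [i], and drawing another element of [D]
    leaves a subset of [D]; so [v_drift] pays for the expected cost. *)
Lemma potential_step a s q : occupied s q ->
  \sum_i p i * (move_cost beta a (alg_step a q i) + v (disagree (alg_step a q i) s))
    <= v (disagree a s).
Proof.
case/existsP => j /eqP sj; rewrite /alg_step.
have [_|aq] := boolP (occupied a q).
  rewrite -mulr_suml p_sum mul1r /move_cost big1 ?add0r // => i _.
  by rewrite /udist eqxx mulr0.
have aNq i : a i != q by move: aq; rewrite negb_exists => /forallP.
set D := disagree a s.
have jD : j \in D by rewrite inE sj.
have cost i : move_cost beta a (move a i q) = beta i.
  rewrite /move_cost (bigD1 i) //= big1 ?addr0.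
    by rewrite /udist ffunE eqxx aNq mulr1.
  by move=> l li; rewrite /udist ffunE (negbTE li) eqxx mulr0.
have sub i : disagree (move a i q) s \subset i |: D.
  by apply/subsetP => l; rewrite !inE ffunE; case: (l == i).
have eqj : disagree (move a j q) s \subset D :\ j.
  apply/subsetP => l; rewrite !inE ffunE; case: (eqVneq l j) => [->|] //=.
  by rewrite sj eqxx.
apply: le_trans (_ : _ <= \sum_i (p i * beta i + p i * v D +
   (if i \notin D then p i * (v (i |: D) - v D) else 0) -
   (if i == j then p j * (v D - v (D :\ j)) else 0))) _.
  apply: ler_sum => i _; rewrite cost mulrDr -!addrA lerD2l.
  have [->|ij] := eqVneq i j.
    rewrite jD /= add0r -mulrBr ler_wpM2l // opprB addrC subrK.
    exact: potential_le.
  rewrite subr0; have := potential_le _ _ (sub i).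
  case: ifP => [_|/negbFE iD] h.
    by rewrite -mulrDr ler_wpM2l // addrC subrK.
  rewrite addr0 ler_wpM2l //; apply: le_trans h _.
  by rewrite (setUidPr _) ?sub1set.
rewrite sumrB !big_split /= -mulr_suml p_sum mul1r -!big_mkcond /= big_pred1_eq.
by have := v_drift _ _ jD; lra.
Qed.

Lemma expect_cost_le (c0 : config k T) (A : adversary k T) n :
  expect p n (alg_cost beta c0 A) <= c * expect p n (adv_cost beta c0 A).
Proof.
(* [X] is a supermartingale: [potential_serve] covers the adversary's move and [potential_step] the
   answer. It starts at 0, and its potential term is never negative. *)
pose X w := alg_cost beta c0 A w
  + v (disagree (last c0 (alg_traj c0 A w)) (last c0 (adv_traj A (alg_traj c0 A w))))
  - c * adv_cost beta c0 A w.
have h : expect p n X <= X [::].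
  apply: expect_le_init => // w; rewrite /X /alg_cost /adv_cost.
  set h := alg_traj c0 A w; set a := last c0 h; set s := last c0 (adv_traj A h).
  have h1 := potential_serve a s (serve A h).
  have h2 := potential_step a (serve A h) (request A h) (serveP A h).
  under eq_bigr => i _ do rewrite alg_traj_rcons adv_traj_rcons !path_cost_rcons
    !last_rcons -/h -/a -/s.
  set ca := path_cost _ _ h; set cs := path_cost _ _ (adv_traj A h).
  set g := move_cost beta s (serve A h) in h1 *.
  apply: le_trans (_ : _ <= \sum_i (p i * (ca - c * (cs + g)) + p i *
    (move_cost beta a (alg_step a (request A h) i)
     + v (disagree (alg_step a (request A h) i) (serve A h))))) _.
    by apply: ler_sum => i _; lra.
  by rewrite big_split /= -mulr_suml p_sum mul1r; move: h1 h2; lra.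
have X0 : X [::] = 0.
  by rewrite /X /alg_cost /adv_cost /path_cost /= !big_nil disagreexx v0; ring.
rewrite X0 in h; rewrite -subr_le0; apply: le_trans h.
rewrite /expect mulr_sumr -sumrB; apply: ler_sum => w _.
rewrite mulrCA -mulrBr ler_wpM2l ?prodr_ge0 // /X.
have := potential_ge0 (disagree (last c0 (alg_traj c0 A w))
  (last c0 (adv_traj A (alg_traj c0 A w)))).
lra.
Qed.
End PotentialMethod.

(** * The algorithm *)

(** The position in a sorted list breaks ties between equal weights, so ranks are injective. *)
Definition rank (R : realType) k (beta : 'I_k -> R) (i : 'I_k) : nat :=
  index i (sort (fun x y => beta x <= beta y) (enum 'I_k)).

Definition mass (R : realType) k (beta : 'I_k -> R) i : R :=
  (share k (rank R k beta i))%:R / beta i.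

Section Masses.
Variables (R : realType) (k : nat) (beta : 'I_k -> R).
Hypotheses (k_gt0 : (0 < k)%N) (beta_gt0 : forall i, 0 < beta i).

Let mem_sort_enum i : i \in sort (fun x y => beta x <= beta y) (enum 'I_k).
Proof. by rewrite mem_sort mem_enum. Qed.

Lemma rank_lt i : (rank R k beta i < k)%N.
Proof.
rewrite -[ltnRHS](size_enum_ord k) -(size_sort (fun x y => beta x <= beta y)).
by rewrite index_mem.
Qed.

Lemma rank_inj : injective (rank R k beta).
Proof. by move=> i j; apply: index_inj. Qed.

Lemma rank_beta i j : (rank R k beta i < rank R k beta j)%N -> beta i <= beta j.
Proof.
move=> ij; apply: (sorted_ltn_index (leT := fun x y => beta x <= beta y) _ _ i j) => //.
  by move=> x y z; apply: le_trans.
by apply: sort_sorted => x y; apply: le_total.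
Qed.

Lemma mass_gt0 i : 0 < mass R k beta i.
Proof. by rewrite divr_gt0 // ltr0n share_gt0 // rank_lt. Qed.

Lemma mass_anti i j : (rank R k beta i < rank R k beta j)%N ->
  mass R k beta j <= mass R k beta i.
Proof.
move=> ij; apply: ler_pM; rewrite ?ler0n ?invr_ge0 //; first exact: ltW.
  by rewrite ler_nat share_anti // rank_lt.
by rewrite lef_pV2 ?posrE // rank_beta.
Qed.

Lemma mass_sum_gt0 : 0 < \sum_i mass R k beta i.
Proof.
rewrite (bigD1 (Ordinal k_gt0)) //= ltr_wpDr ?mass_gt0 //.
by apply: sumr_ge0 => i _; apply/ltW/mass_gt0.
Qed.
End Masses.

Theorem theorem1 (R : realType) (k : nat) (hk : (0 < k)%N) :
  exists M : memoryless_algorithm R k,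
    forall beta : 'I_k -> R, (forall i, 0 < beta i) ->
      competitive M beta (alpha k)%:R.
Proof.
pose prob beta i : R := mass R k beta i / \sum_j mass R k beta j.
have prob_gt0 beta : (forall i, 0 < beta i) -> forall i, 0 < prob beta i.
  by move=> b0 i; rewrite divr_gt0 ?mass_gt0 ?mass_sum_gt0.
have prob_ge0 beta : (forall i, 0 < beta i) -> forall i, 0 <= prob beta i.
  by move=> b0 i; rewrite ltW ?prob_gt0.
have prob_sum beta : (forall i, 0 < beta i) -> \sum_i prob beta i = 1.
  by move=> b0; rewrite -mulr_suml divff // gt_eqF ?mass_sum_gt0.
exists (MemorylessAlgorithm prob_ge0 prob_sum) => beta b0.
(* No additive constant arises: both sides start in the same configuration, where the potential is
   0. *)
exists 0 => T c0 A n; rewrite addr0 /=.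
set r := rank R k beta; set Z := \sum_j mass R k beta j.
have Z0 : 0 < Z by apply: mass_sum_gt0.
have p0 := prob_gt0 beta b0; have ps := prob_sum beta b0.
pose cost := \sum_i prob beta i * beta i.
have cost_ge0 : 0 <= cost by apply: sumr_ge0 => i _; rewrite ltW // mulr_gt0.
(* [prob beta i * beta i * Z] is the share of [i], so [cost * Z] is the sum of all shares. *)
have costZ : cost * Z <= (alpha k)%:R.
  apply: le_trans _ (share_sum R _ r (rank_inj R k beta) k).
  rewrite /cost mulr_suml [leRHS]big_mkcond /=; apply: ler_sum => i _.
  rewrite rank_lt /prob -/Z /mass -/r.
  have bn : beta i != 0 by rewrite gt_eqF.
  have Zn : Z != 0 by rewrite gt_eqF.
  by rewrite le_eqVlt; apply/orP; left; apply/eqP; field; rewrite bn Zn.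
(* The chain needs total probability at most 1/2, hence the halved probabilities. *)
have hp i : 0 < prob beta i / 2 by rewrite divr_gt0.
have hs : \sum_i prob beta i / 2 <= 2^-1 by rewrite -mulr_suml ps mul1r.
have ha i j : (r i < r j)%N -> prob beta j / 2 <= prob beta i / 2.
  by move=> ij; rewrite ler_wpM2r ?invr_ge0 // ler_wpM2r ?invr_ge0 ?mass_anti // ltW.
have [v [v0 vm vl vd]] := potential_exists R _ r (fun i => prob beta i / 2) k
  (rank_inj R k beta) (rank_lt R k beta) hp hs ha.
(* [cost], the expected price of a fault, turns steps into cost; the factor 1/2 undoes the
   halving. *)
pose Phi D := cost / 2 * v D.
have c2 : 0 <= cost / 2 by rewrite divr_ge0.
apply: (expect_cost_le R k _ beta _ Phi) => //.
- by move=> i; rewrite ltW.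
- by move=> i; rewrite ltW.
- by rewrite /Phi v0 mulr0.
- by move=> D i iD; rewrite ler_wpM2l ?vm.
- move=> D i iD; rewrite -lerBlDl -mulrBr.
  apply: le_trans (_ : _ <= cost * Z * beta i) _; last by rewrite ler_wpM2r // ltW.
  have := vl D i iD; set d := v _ - v _ => h.
  have hd : d <= 2 * (beta i * Z).
    have e : prob beta i / 2 * (2 * (beta i * Z)) = (share k (r i))%:R.
      rewrite /prob -/Z /mass -/r.
      have bn : beta i != 0 by rewrite gt_eqF.
      have Zn : Z != 0 by rewrite gt_eqF.
      by field; rewrite bn Zn.
    by move: h; rewrite -e ler_pM2l // divr_gt0.
  have := ler_wpM2l c2 hd; lra.
move=> D j jD; rewrite -/cost /Phi.
have := ler_wpM2l cost_ge0 (vd D j jD).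
rewrite mulrDr mulr1 mulr_sumr => h.
rewrite (eq_bigr (fun i => cost * (prob beta i / 2 * (v (i |: D) - v D)))).
  by move: h; lra.
by move=> i _; ring.
Qed.
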